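(* Let $f:\mathbb{R}^d\to\mathbb{R}$ be a potential with $\nu_*=e^{-f}$. Suppose that for some $\alpha\in[1,2]$ and $a,b>0$, $$\langle\nabla f(x),x\rangle\ge a\|x\|^\alpha-b\quad\text{for all }x\in\mathbb{R}^d,$$ and that for some positive constant $\zeta\le\alpha/2$ and some constant $M$, $$\|\nabla f(x)\|\le M(1+\|x\|^\zeta)\quad\text{for all }x\in\mathbb{R}^d .$$ Let $\rho_k$ denote the distribution of the $k$-th iterate of LMC with step size $\eta\le\frac12\left(1\wedge\frac{a}{2M^2}\right)$. Then for every even integer $s\ge2$ and every $k$, $$\mathcal{M}_s(\rho_k+\nu_* )\le \mathcal{M}_s(\rho_0+\nu_* )+C_s k\eta,$$ where $$C_s=\left(\frac{3a+2b+3}{1\wedge a}\right)^{\frac{s-2}{\alpha}+1}s^s d^{\frac{s-2}{\alpha}+1}.$$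
   Context: A potential is a (differentiable) function $f:\mathbb{R}^d\to\mathbb{R}$ with $\int e^{-f(x)}dx=1$; $\nu_*=e^{-f}$. The Langevin Monte Carlo (LMC) algorithm with step size $\eta>0$ is $x_{k+1}=x_k-\eta\nabla f(x_k)+\sqrt{2\eta}\,W_k$, where $W_k$ is a standard Gaussian vector in $\mathbb{R}^d$ independent of $W_m$ and $x_m$ for $m<k$ (and of $x_k$); $\rho_0$ is the law of $x_0$. $\|\cdot\|$ is the Euclidean norm, $u\wedge v=\min(u,v)$. For a function $g$ on $\mathbb{R}^d$, $\mathcal{M}_s(g)=\int(1+\|x\|^2)^{s/2}g(x)\,dx$; distributions are identified with their densities. *)

(* Defs.v *)
From HB Require Import structures.
From mathcomp Require Import all_boot all_order all_algebra.
From mathcomp Require Import all_classical all_reals all_analysis.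
From mathcomp Require Import measurable_realfun.
Set Implicit Arguments.
Unset Strict Implicit.
Unset Printing Implicit Defensive.
Import Order.TTheory GRing.Theory Num.Theory.
Import numFieldNormedType.Exports.
Local Open Scope classical_set_scope.
Local Open Scope ring_scope.

Definition measure_rV_display : measure_display -> measure_display.
Proof. exact. Qed.

(* Row vectors carry the product sigma-algebra; over a realType it is the
   Borel one, since open sets belong to it (open_measurable_rV). *)
Section measurable_rV.
Context {d} {T : measurableType d} (n : nat).

Let coors : 'I_n -> 'rV[T]_n -> T := fun i x => x ord0 i.

Let rV_set0 : g_sigma_preimage coors set0.
Proof. exact: sigma_algebra0. Qed.

Let rV_setC A : g_sigma_preimage coors A -> g_sigma_preimage coors (~` A).
Proof. exact: sigma_algebraC. Qed.

Let rV_bigcup (F : _^nat) : (forall i, g_sigma_preimage coors (F i)) ->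
  g_sigma_preimage coors (\bigcup_i (F i)).
Proof. exact: sigma_algebra_bigcup. Qed.

HB.instance Definition _ := @isMeasurable.Build (measure_rV_display d)
  'rV[T]_n (g_sigma_preimage coors) rV_set0 rV_setC rV_bigcup.

Lemma measurable_coord_rV (i : 'I_n) :
  measurable_fun [set: 'rV[T]_n] (fun x : 'rV[T]_n => x ord0 i).
Proof.
move=> _ Y mY; rewrite setTI; apply: sub_sigma_algebra => /=.
rewrite -bigcup_seq/=; exists i => /=; first by rewrite mem_index_enum.
by exists Y => //; rewrite setTI.
Qed.

End measurable_rV.

Lemma measurable_fun_rVP d1 d2 (T1 : measurableType d1) (T2 : measurableType d2)
    n (f : T1 -> 'rV[T2]_n) :
  measurable_fun [set: T1] f <->
  forall i, measurable_fun [set: T1] (fun x => f x ord0 i).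
Proof.
split=> [mf i|mf].
  exact: (measurableT_comp (measurable_coord_rV i) mf).
move=> _ A mA; rewrite setTI.
suff : measurable `<=` [set B | measurable (f @^-1` B)] by exact.
apply: smallest_sub.
  split => /=.
  - by rewrite preimage_set0.
  - by move=> B mB; rewrite setTD preimage_setC; exact: measurableC.
  - by move=> F mF; rewrite preimage_bigcup; exact: bigcupT_measurable.
rewrite -bigcup_seq/=; apply: bigcup_sub => i _ B [C mC <-]/=.
rewrite setTI -[X in measurable X]setTI.
exact: (mf i).
Qed.

Lemma open_measurable_rV (R : realType) n (A : set 'rV[R]_n) :
  open A -> measurable A.
Proof.
move=> oA.
pose box (q : 'rV[rat]_n * rat) : set 'rV[R]_n :=
  [set y | forall i, `|ratr (q.1 ord0 i) - y ord0 i| < ratr q.2].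
pose F q := if `[< box q `<=` A >] then box q else set0.
suff -> : A = \bigcup_q F q.
  apply: countable_bigcupT_measurable => [//|q].
  rewrite /F; case: ifPn => // _.
  have -> : box q = \bigcap_(i in [set: 'I_n])
      [set y : 'rV[R]_n | `|ratr (q.1 ord0 i) - y ord0 i| < ratr q.2].
    by apply/seteqP; split => y /= h i *; apply: h.
  apply: fin_bigcap_measurable => // i _.
  rewrite [X in measurable X](_ : _ = (fun x : 'rV[R]_n => x ord0 i) @^-1`
      ball (ratr (q.1 ord0 i) : R) (ratr q.2)) //.
  rewrite -[X in measurable X]setTI; apply: measurable_coord_rV => //.
  by rewrite ball_itv; exact: measurable_itv.
apply/seteqP; split => [x Ax|x [q _]]; last first.
  by rewrite /F; case: ifPn => // /asboolP; exact.
have /nbhs_ballP[e /= e0 xeA] : nbhs x A by exact: open_nbhs_nbhs.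
have [r] : exists r, ratr r \in `]0, e / 2[ by apply: rat_in_itvoo; rewrite divr_gt0.
rewrite in_itv/= => /andP[r0 re].
have /choice[q qP] (i : 'I_n) :
    exists q, ratr q \in `](x ord0 i - ratr r), (x ord0 i + ratr r)[.
  by apply: rat_in_itvoo; rewrite ltrBlDr -addrA ltrDl addr_gt0.
have {}qP i : `|ratr (q i) - x ord0 i| < ratr r.
  by have := qP i; rewrite in_itv/= -ltr_distl.
exists ((\row_i q i), r) => //; rewrite /F; case: ifPn => [_ i|/asboolP[]].
  by rewrite mxE.
move=> y /= ry; apply: xeA; split => // i j; rewrite ord1 /ball/=.
have := ry j; rewrite mxE => ryj.
rewrite -(subrKA (ratr (q j))) (le_lt_trans (ler_normD _ _))//.
by rewrite (splitr e) ltrD// (lt_trans _ re)// distrC.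
Qed.

Lemma continuous_measurable_rV (R : realType) n (f : 'rV[R]_n -> R) :
  continuous f -> measurable_fun setT f.
Proof.
move=> /continuousP cf; apply: (measurability _ (RGenOInfty.measurableE R)).
move=> _ [_ [a ->] <-]; rewrite setTI; apply: open_measurable_rV.
exact/cf/interval_open.
Qed.

Section rV_product_measure.
Context {R : realType}.
Local Notation mR := (measurableTypeR R).

Definition rVcons n (p : mR * 'rV[R]_n) : 'rV[R]_n.+1 :=
  row_mx (p.1 : R)%:M p.2.

Lemma measurable_rVcons n : measurable_fun [set: mR * 'rV[R]_n] (@rVcons n).
Proof.
apply/measurable_fun_rVP => i.
have [j ij|j ij] := @split_ordP 1 n i.
  rewrite (_ : (fun _ => _) = fst); first exact: measurable_fst.
  by apply/funext => p; rewrite ij /rVcons (@row_mxEl _ 1 1 n) (ord1 j) mxE.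
rewrite (_ : (fun _ => _) = (fun x : 'rV[R]_n => x ord0 j) \o snd).
  exact: measurableT_comp (measurable_coord_rV j) measurable_snd.
by apply/funext => p; rewrite ij /rVcons (@row_mxEr _ 1 1 n).
Qed.

HB.instance Definition _ n := isMeasurableFun.Build _ _ _ _
  (@rVcons n) (@measurable_rVcons n).

Section step.
Variables (mu : {sigma_finite_measure set mR -> \bar R}) (n : nat)
  (nu : {sigma_finite_measure set 'rV[R]_n -> \bar R}).

Definition rVcons_measure : set 'rV[R]_n.+1 -> \bar R :=
  pushforward (mu \x nu)%E (@rVcons n).

Let rVcons_measure0 : rVcons_measure set0 = 0%E.
Proof. by rewrite /rVcons_measure /pushforward preimage_set0 measure0. Qed.

Let rVcons_measure_ge0 A : (0 <= rVcons_measure A)%E.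
Proof. exact: (measure_ge0 (mu \x nu)%E). Qed.

Let rVcons_measure_sigma_additive : semi_sigma_additive rVcons_measure.
Proof. exact: measure_semi_sigma_additive. Qed.

HB.instance Definition _ := isMeasure.Build _ _ _ rVcons_measure
  rVcons_measure0 rVcons_measure_ge0 rVcons_measure_sigma_additive.

Let rVcons_measure_sigma_finite : sigma_finite setT rVcons_measure.
Proof.
have /sigma_finiteP[F [FT ndF Foo]] := sigma_finiteT mu.
have /sigma_finiteP[G [GT ndG Goo]] := sigma_finiteT nu.
pose u (x : 'rV[R]_n.+1) : mR * 'rV[R]_n :=
  (x ord0 ord0, @rsubmx _ 1 1 n x).
have uK p : u (rVcons p) = p.
  case: p => a v; congr pair; last exact: (@row_mxKr _ 1 1 n).
  have -> : ord0 = @lshift 1 n ord0 by exact/val_inj.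
  by rewrite /rVcons (@row_mxEl _ 1 1 n) mxE.
have mu_ : measurable_fun setT u.
  apply/measurable_fun_pairP; split; first exact: measurable_coord_rV.
  apply/measurable_fun_rVP => j; rewrite (_ : (fun _ => _) =
    (fun x : 'rV[R]_n.+1 => x ord0 (@rshift 1 n j))).
    exact: measurable_coord_rV.
  by apply/funext => x; rewrite /u/= mxE.
exists (fun i => u @^-1` (F i `*` G i)).
  rewrite -preimage_bigcup -[LHS](preimage_setT u); congr (_ @^-1` _).
  rewrite -setXTT FT GT predeqE => -[x y]; split.
    move=> [/= [k _ Fkx] [l _ Gly]]; exists (maxn k l) => //; split.
    - by move: x Fkx; exact/subsetPset/ndF/leq_maxl.
    - by move: y Gly; exact/subsetPset/ndG/leq_maxr.
  by move=> [k _ []/= ? ?]; split; exists k.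
move=> k; have [mF Fk] := Foo k; have [mG Gk] := Goo k; split.
  by rewrite -[X in measurable X]setTI; apply: mu_ => //; exact: measurableX.
rewrite /rVcons_measure /pushforward -comp_preimage (_ : u \o _ = id).
  by rewrite product_measure1E// lte_mul_pinfty// ge0_fin_numE.
exact/funext.
Qed.

HB.instance Definition _ := Measure_isSigmaFinite.Build _ _ _ rVcons_measure
  rVcons_measure_sigma_finite.

End step.

(* n-fold product mu \x ... \x mu, as a measure on row vectors *)
Fixpoint rV_product_measure (mu : {sigma_finite_measure set mR -> \bar R}) n :
    {sigma_finite_measure set 'rV[R]_n -> \bar R} :=
  match n with
  | 0 => [the {sigma_finite_measure set 'rV[R]_0 -> \bar R} of
              dirac (0 : 'rV[R]_0)]
  | m.+1 => [the {sigma_finite_measure set 'rV[R]_m.+1 -> \bar R} of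
              rVcons_measure mu (rV_product_measure mu m)]
  end.

Definition lebesgue_rV n : {sigma_finite_measure set 'rV[R]_n -> \bar R} :=
  rV_product_measure lebesgue_measure n.

Definition std_gaussian n : {sigma_finite_measure set 'rV[R]_n -> \bar R} :=
  rV_product_measure (normal_prob 0 1) n.

End rV_product_measure.

Section euclidean.
Context {R : realType} {d : nat}.
Implicit Types x y : 'rV[R]_d.

Definition dotrV x y : R := \sum_i x ord0 i * y ord0 i.

(* the library norm `|x| of matrices is the sup norm *)
Definition enorm x : R := Num.sqrt (dotrV x x).

(* row of partial derivatives; only used where f is differentiable *)
Definition grad (f : 'rV[R]_d -> R) x : 'rV[R]_d :=
  \row_i 'D_(delta_mx ord0 i) f x.

(* a density g is identified with the measure g dx: for mu = g dx this is the
   integral of (1 + |x|^2)^(s/2) g(x) *)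
Definition moment (s : R) (mu : set 'rV[R]_d -> \bar R) : \bar R :=
  \int[mu]_x ((1 + enorm x ^+ 2) `^ (s / 2))%:E.

End euclidean.

Section potential.
Context (R : realType) (d : nat).

Record potential := Potential {
  potential_fun :> 'rV[R]_d -> R ;
  potential_differentiable : forall x, differentiable potential_fun x ;
  potential_normalized :
    (\int[lebesgue_rV d]_x (expR (- potential_fun x))%:E = 1)%E }.

Variable f : potential.

Lemma measurable_potential : measurable_fun setT f.
Proof.
apply: continuous_measurable_rV => x.
exact/differentiable_continuous/potential_differentiable.
Qed.

(* the probability measure with Lebesgue density exp(-f) *)
Definition gibbs (A : set 'rV[R]_d) : \bar R :=
  (\int[lebesgue_rV d]_(x in A) (expR (- f x))%:E)%E.

Let gibbs0 : gibbs set0 = 0%E.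
Proof. by rewrite /gibbs integral_set0. Qed.

Let gibbs_ge0 A : (0 <= gibbs A)%E.
Proof. by apply: integral_ge0 => x _; rewrite lee_fin expR_ge0. Qed.

Let gibbs_sigma_additive : semi_sigma_additive gibbs.
Proof.
move=> F mF tF mUF; rewrite /gibbs ge0_integral_bigcup//.
- apply: is_cvg_ereal_nneg_natsum_cond => n _ _.
  by apply: integral_ge0 => x _; rewrite lee_fin expR_ge0.
- apply: measurable_funTS; apply/measurable_EFinP.
  do 2!apply: measurableT_comp => //; exact: measurable_potential.
Qed.

HB.instance Definition _ := isMeasure.Build _ _ _ gibbs
  gibbs0 gibbs_ge0 gibbs_sigma_additive.

Let gibbs_setT : gibbs setT = 1%E.
Proof. exact: potential_normalized. Qed.

HB.instance Definition _ := Measure_isProbability.Build _ _ _ gibbs gibbs_setT.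

End potential.

Section langevin_monte_carlo.
Context {R : realType} {d : nat} {dT : measure_display} {T : measurableType dT}.
Variables (P : probability T R) (f : 'rV[R]_d -> R) (eta : R).
Variables X W : nat -> {RV P >-> 'rV[R]_d}.

(* sigma(X_0, ..., X_k, W_0, ..., W_(k-1)) *)
Definition lmc_past k : set (set T) :=
  <<s \bigcup_(m in `I_k.+1) preimage_set_system setT (X m) measurable `|`
      \bigcup_(m in `I_k) preimage_set_system setT (W m) measurable >>.

Definition lmc : Prop := forall k,
  [/\ forall A, measurable A -> distribution P (W k) A = std_gaussian d A,
      forall A B, measurable A -> lmc_past k B ->
        P (W k @^-1` A `&` B) = (P (W k @^-1` A) * P B)%E &
      forall t, X k.+1 t =
        X k t - eta *: grad f (X k t) + Num.sqrt (2 * eta) *: W k t].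

End langevin_monte_carlo.

(* Main.v *)
Require Import Defs.
From HB Require Import structures.
From mathcomp Require Import all_boot all_order all_algebra.
From mathcomp Require Import all_classical all_reals all_analysis.
From mathcomp Require Import measurable_realfun ring lra zify.
Set Implicit Arguments.
Unset Strict Implicit.
Unset Printing Implicit Defensive.
Import Order.TTheory GRing.Theory Num.Theory.
Import numFieldNormedType.Exports.
Local Open Scope classical_set_scope.
Local Open Scope ring_scope.

(* The moments of exp(-f) appear on both sides, so it suffices to bound the
   increment of E(1 + |X_k|^2)^m over one step, where s = 2m. Given X_k = x,
   the drift moves x to y with
     |y|^2 <= |x|^2 + eta (2b + a - (3/2) a |x|^alpha),
   and integrating the Gaussian noise one coordinate at a time gives
     E(1 + |y + sqrt(2 eta) W|^2)^m <= (1 + |y|^2 + 2 eta d (2m - 1))^m,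
   since C(2m, 2k) (2k - 1)!! <= C(m, k) (2m - 1)^k. The resulting base exceeds
   1 + |x|^2 only if |x|^alpha is at most a multiple of m d, where convexity of
   the m-th power bounds the increment by C_s eta. *)

(** * Binomial coefficients and even powers *)

(** Passing from [k] to [k+1] multiplies the left side by [(m-k)(2m-2k-1)/(k+1)] and the right side
    by [(m-k)q/(k+1)], and [2m-2k-1 <= q]. The product of odd numbers is [(2k-1)!!]. *)
Lemma bin_double_odd_prod_le (q m k : nat) : (m.*2 <= q.+1)%N ->
  ('C(m.*2, k.*2) * \prod_(i < k) i.*2.+1 <= 'C(m, k) * q ^ k)%N.
Proof.
move=> mq; elim: k => [|k IH]; first by rewrite big_ord0 !bin0.
rewrite big_ord_recr/= -(leq_pmul2l (ltn0Sn k)).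
have e1 := mul_bin_left m.*2 k.*2.+1.
have e2 := mul_bin_left m.*2 k.*2.
have e3 := mul_bin_left m k.
rewrite [leqRHS]mulnA e3 expnS.
have -> : (k.+1 * ('C(m.*2, (k.+1).*2) *
                   (\prod_(i < k) (nat_of_ord i).*2.+1 * k.*2.+1)) =
  (m - k) * (m.*2 - k.*2.+1) *
    ('C(m.*2, k.*2) * \prod_(i < k) (nat_of_ord i).*2.+1))%N.
  apply/eqP; rewrite -(eqn_pmul2l (ltn0Sn 1)); apply/eqP.
  rewrite doubleS; set P := (\prod_(i < k) _)%N.
  have -> : (2 * ((m - k) * (m.*2 - k.*2.+1) * ('C(m.*2, k.*2) * P)) =
    (m.*2 - k.*2.+1) * P * ((m.*2 - k.*2) * 'C(m.*2, k.*2)))%N.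
    by rewrite -doubleB -!mul2n; ring.
  rewrite -e2.
  have -> : ((m.*2 - k.*2.+1) * P * (k.*2.+1 * 'C(m.*2, k.*2.+1)) =
    P * k.*2.+1 * ((m.*2 - k.*2.+1) * 'C(m.*2, k.*2.+1)))%N by ring.
  by rewrite -e1 -!mul2n; ring.
have -> : ((m - k) * 'C(m, k) * (q * q ^ k) =
           (m - k) * q * ('C(m, k) * q ^ k))%N by ring.
by apply: leq_mul => //; apply: leq_mul => //; lia.
Qed.

Lemma sum_ord_double (V : zmodType) (F : nat -> V) j :
  \sum_(i < j.*2.+1) F i = \sum_(k < j.+1) F k.*2 + \sum_(k < j) F k.*2.+1.
Proof.
elim: j => [|j IH]; first by rewrite !big_ord_recr !big_ord0 /= addr0.
rewrite doubleS big_ord_recr big_ord_recr/= IH.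
rewrite [X in _ = X + _]big_ord_recr [X in _ = _ + X]big_ord_recr/=.
by rewrite [RHS]addrACA -[in LHS]addrA; congr (_ + _); rewrite addrC.
Qed.

(** In the two binomial expansions the odd powers of [y] cancel and the even ones double. *)
Lemma exprDn_even_part (K : comRingType) (x y : K) j :
  (x + y) ^+ j.*2 + (x - y) ^+ j.*2 =
  (\sum_(k < j.+1) (x ^+ 2) ^+ (j - k) * (y ^+ 2) ^+ k *+ 'C(j.*2, k.*2)) *+ 2.
Proof.
rewrite !exprDn -big_split/=.
rewrite (sum_ord_double (fun i => x ^+ (j.*2 - i) * y ^+ i *+ 'C(j.*2, i) +
   x ^+ (j.*2 - i) * (- y) ^+ i *+ 'C(j.*2, i))).
rewrite [X in _ + X]big1 ?addr0 => [|k _]; last first.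
  rewrite [(- y) ^+ _]exprNn -signr_odd /= odd_double expr1 mulN1r.
  by rewrite mulrN -mulrnDl subrr mul0rn.
rewrite -sumrMnl; apply: eq_bigr => k _.
rewrite -doubleB -!mul2n !exprM sqrrN -mulrnDl -mulr2n mulrnAC //.
Qed.

(** * Even moments of the standard normal law *)

Section normal_moments.
Context {R : realType}.
Local Notation mu := (@lebesgue_measure R).

(** The Radon-Nikodym derivative of the normal law agrees almost everywhere with [normal_pdf], since
    both have the same integral over every measurable set. *)
Lemma ge0_integral_normal_prob (m s : R) (g : R -> \bar R) :
  measurable_fun setT g -> (forall x, 0 <= g x)%E ->
  (\int[normal_prob m s]_x g x = \int[mu]_x (g x * (normal_pdf m s x)%:E))%E.
Proof.
move=> mg g0; have dom := @normal_prob_dominates R m s.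
rewrite -(Radon_Nikodym_SigmaFinite.change_of_variables dom)//.
have mRN := measurable_int _ (Radon_Nikodym_SigmaFinite.f_integrable dom).
have mpdf : measurable_fun setT (fun x => (normal_pdf m s x)%:E).
  by apply/measurable_EFinP; exact: measurable_normal_pdf.
apply: ae_eq_integral => //; try exact: emeasurable_funM.
apply: ae_eqe_mul2l; apply: integral_ae_eq => //.
  exact: Radon_Nikodym_SigmaFinite.f_integrable.
by move=> A _ mA; rewrite -Radon_Nikodym_SigmaFinite.f_integral.
Qed.

(** The centred density is even and Lebesgue measure is invariant under reflection. *)
Lemma ge0_integral_normal_probN (s : R) (g : R -> \bar R) : s != 0 ->
  measurable_fun setT g -> (forall x, 0 <= g x)%E ->
  (\int[normal_prob 0 s]_x g (- (x : R))%R = \int[normal_prob 0 s]_x g x)%E.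
Proof.
move=> s0 mg g0; pose G (x : R) := (g x * (normal_pdf 0 s x)%:E)%E.
have mpdf : measurable_fun setT (fun x : R => (normal_pdf 0 s x)%:E).
  by apply/measurable_EFinP; exact: measurable_normal_pdf.
have mG : measurable_fun setT G by exact: emeasurable_funM.
have G0 x : (0 <= G x)%E by rewrite mule_ge0// lee_fin normal_pdf_ge0.
rewrite !ge0_integral_normal_prob//; last first.
  by apply: measurableT_comp => //; exact: oppr_measurable.
transitivity (\int[mu]_x G (- (x : R))%R)%E.
  apply: eq_integral => x _; rewrite /G; congr (_ * _%:E)%E.
  by rewrite !normal_pdfE// /normal_fun !subr0 sqrrN.
have mN : measurable_fun setT (-%R : measurableTypeR R -> measurableTypeR R).
  exact: oppr_measurable.
have := ge0_integral_pushforward mN mu measurableT mG (fun x _ => G0 x).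
rewrite preimage_setT => <-.
by apply: eq_measure_integral => A mA _; exact: lebesgue_measureN.
Qed.

(** Integration by parts, with [x phi(x)] the derivative of [- phi]. An inequality suffices, so the
    boundary term on a bounded interval is dropped by its sign instead of being shown to vanish at
    infinity. *)
Lemma normal_even_moment_step k :
  (\int[normal_prob (0:R) 1]_(x in setT) ((x : R) ^+ k.+1.*2)%:E <=
   (k.*2.+1)%:R%:E *
     \int[normal_prob (0:R) 1]_(x in setT) ((x : R) ^+ k.*2)%:E)%E.
Proof.
have [c c0 phiE] : exists2 c : R, 0 <= c &
    normal_pdf 0 1 = fun x : R => c * expR (- (x ^+ 2) / 2).
  exists (normal_peak 1); first exact: normal_peak_ge0.
  apply/funext => x; rewrite normal_pdfE ?oner_eq0// /normal_fun subr0.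
  by rewrite expr1n.
set phi := normal_pdf (0 : R) 1 in phiE.
have phi0 x : 0 <= phi x by exact: normal_pdf_ge0.
have cphi : continuous phi by apply: continuous_normal_pdf; exact: oner_neq0.
have dphi (x : R) : is_derive x 1 (- phi) (x * phi x).
  have -> : - phi = fun x => - (c * expR (- (x ^+ 2) / 2)) by rewrite phiE.
  by rewrite phiE; apply: is_derive_eq; rewrite /GRing.scale/=; field.
have dpow n (x : R) : is_derive x 1 (fun x => x ^+ n.+1) (n.+1%:R * x ^+ n).
  have -> : (fun x : R => x ^+ n.+1) = (@id R) ^+ n.+1.
    by apply/funext => y; rewrite fctE.
  by apply: is_derive_eq; rewrite /GRing.scale/= mulr1.
(* On [-r, r], integration by parts leaves a nonpositive boundary term. *)
have trunc (r : R) : 0 < r ->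
    (\int[mu]_(x in `[(- r)%R, r]) (x ^+ k.+1.*2 * phi x)%:E <=
     (k.*2.+1)%:R%:E * \int[mu]_(x in `[(- r)%R, r]) (x ^+ k.*2 * phi x)%:E)%E.
  move=> r0; have mr : - r < r by rewrite -subr_gt0 opprK addr_gt0.
  have cpow n : continuous (fun x : R => x ^+ n).
    by move=> x; exact: exprn_continuous.
  have LR (F : R -> R) (dF : R -> R) : (forall x : R, is_derive x 1 F (dF x)) ->
      derivable_oo_LRcontinuous F (- r) r.
    move=> FdF; have cF : continuous F.
      move=> x; apply: differentiable_continuous; apply/derivable1_diffP.
      exact: (@ex_derive _ _ _ _ _ _ _ (FdF x)).
    split; last 2 first.
    - exact: cvg_at_right_filter (cF _).
    - exact: cvg_at_left_filter (cF _).
    - by move=> x _; exact: (@ex_derive _ _ _ _ _ _ _ (FdF x)).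
  have -> : (\int[mu]_(x in `[(- r)%R, r]) (x ^+ k.+1.*2 * phi x)%:E =
             \int[mu]_(x in `[(- r)%R, r]) (x ^+ k.*2.+1 * (x * phi x))%:E)%E.
    by apply: eq_integral => x _; rewrite mulrA -exprSr doubleS.
  rewrite (@integration_by_parts R (fun x => x ^+ k.*2.+1) (- phi)
    (fun x => k.*2.+1%:R * x ^+ k.*2) (fun x => x * phi x) (- r) r mr).
  - have -> : (\int[mu]_(x in `[(- r)%R, r])
        (k.*2.+1%:R * x ^+ k.*2 * (- phi) x)%:E =
      - (k.*2.+1%:R%:E *
         \int[mu]_(x in `[(- r)%R, r]) (x ^+ k.*2 * phi x)%:E))%E.
      have x0 (x : R) : 0 <= x ^+ k.*2 * phi x.
        by rewrite mulr_ge0// -mul2n exprM exprn_ge0// sqr_ge0.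
      rewrite -ge0_integralZl//; last 2 first.
      - apply/measurable_EFinP/measurable_funTS; apply: measurable_funM.
          exact: measurable_funX.
        exact: measurable_normal_pdf.
      - by move=> x _; rewrite lee_fin.
      rewrite -integral_ge0N.
        by apply: eq_integral => x _; rewrite fctE mulrN EFinN -EFinM mulrA.
      by move=> x _; rewrite -EFinM lee_fin mulr_ge0.
    rewrite oppeK geeDr// lee_fin !fctE.
    rewrite [(- r) ^+ _]exprNn -signr_odd /= odd_double expr1 mulN1r.
    rewrite mulrNN mulrN -opprD oppr_le0.
    by rewrite addr_ge0// mulr_ge0// exprn_ge0// ltW.
  - apply: continuous_subspaceT => x; apply: cvgM; [exact: cvg_cst|exact: cpow].
  - exact: LR (dpow _).
  - move=> x _; rewrite derive1E.
    exact: (@derive_val _ _ _ _ _ _ _ (dpow _ x)).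
  - apply: continuous_subspaceT => x; apply: cvgM; [exact: cvg_id|exact: cphi].
  - exact: LR dphi.
  - move=> x _; rewrite derive1E.
    exact: (@derive_val _ _ _ _ _ _ _ (dphi x)).
pose h n (x : R) := (x ^+ n.*2 * phi x)%:E.
have mh n : measurable_fun setT (h n).
  apply/measurable_EFinP; apply: measurable_funM; first exact: measurable_funX.
  exact: measurable_normal_pdf.
have h0 n x : (0 <= h n x)%E.
  by rewrite lee_fin mulr_ge0// -mul2n exprM exprn_ge0// sqr_ge0.
have bnd (n : nat) : (\int[mu]_(x in `[(- n%:R)%R, n%:R]) h k.+1 x <=
     (k.*2.+1)%:R%:E * \int[mu]_x h k x)%E.
  (* [trunc] asks for a positive radius; for [n = 0] the interval is a single point. *)
  have [->|n0] := posnP n.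
    rewrite oppr0 set_itv1 integral_set1 mule_ge0// ?lee_fin//.
    by apply: integral_ge0 => x _; exact: h0.
  have n0R : 0 < n%:R :> R by rewrite ltr0n.
  apply: (le_trans (trunc _ n0R)); apply: lee_wpmul2l; first by rewrite lee_fin.
  exact: (@ge0_subset_integral _ _ R mu _ setT _ _ _ (mh k) (fun x _ => h0 k x)).
have E n : (\int[normal_prob (0:R) 1]_(x in setT) ((x : R) ^+ n.*2)%:E = 
     \int[mu]_x h n x)%E.
  rewrite ge0_integral_normal_prob//.
    by apply/measurable_EFinP; exact: measurable_funX.
  by move=> x; rewrite lee_fin -mul2n exprM exprn_ge0// sqr_ge0.
rewrite !E.
have UT : \bigcup_(n : nat) `[(- n%:R)%R, n%:R : R]%classic = [set: R].
  apply/seteqP; split => // x _; exists (Num.bound `|x|) => //=.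
  by rewrite in_itv/= -ler_norml ltW// archi_boundP.
(* Monotone convergence along the intervals [[-n, n]] carries the bound to the whole line. *)
have cvgI : (\int[mu]_(x in `[(- n%:R)%R, n%:R]) h k.+1 x)%E @[n --> \oo] -->
    (\int[mu]_x h k.+1 x)%E.
  rewrite -UT; apply: ge0_nondecreasing_set_cvg_integral => //.
  - move=> m n mn; apply/subsetPset/subset_itv;
      by rewrite bnd_simp ?lerN2 ler_nat.
  - by move=> n; exact: (measurable_funTS (mh k.+1)).
rewrite -(cvg_lim _ cvgI)//; apply: lime_le; last exact: nearW.
by apply/cvg_ex; eexists; exact: cvgI.
Qed.
Lemma normal_even_moment k :
  (\int[normal_prob (0:R) 1]_(x in setT) ((x : R) ^+ k.*2)%:E <=
   (\prod_(i < k) i.*2.+1)%:R%:E :> \bar R)%E.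
Proof.
elim: k => [|k IH].
  rewrite big_ord0; under eq_integral do rewrite expr0.
  by rewrite integral_cst//= mul1e probability_setT.
apply: (le_trans (normal_even_moment_step k)).
rewrite big_ord_recr/= natrM mulrC EFinM.
by apply: lee_wpmul2l => //; rewrite lee_fin.
Qed.
End normal_moments.

(** Serves to integrate binomial expansions term by term; signs take the place of integrability. *)
Lemma le_integral_sum_nonneg d (T : measurableType d) (R : realType)
    (mu : {measure set T -> \bar R}) n (a b : 'I_n -> R) (g : 'I_n -> T -> R) :
  (forall i, 0 <= a i) -> (forall i, measurable_fun setT (g i)) ->
  (forall i x, 0 <= g i x) ->
  (forall i, \int[mu]_x (g i x)%:E <= (b i)%:E)%E ->
  (\int[mu]_x (\sum_(i < n) a i * g i x)%:E <= (\sum_(i < n) a i * b i)%:E)%E.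
Proof.
move=> a0 mg g0 gb; under eq_integral do rewrite -sumEFin.
rewrite ge0_integral_sum//; last 2 first.
- by move=> i; apply/measurable_EFinP; exact: measurable_funM.
- by move=> i x _; rewrite lee_fin mulr_ge0.
rewrite -sumEFin; apply: lee_sum => i _.
under eq_integral do rewrite EFinM.
rewrite ge0_integralZl// ?lee_fin//.
- by rewrite EFinM lee_wpmul2l ?lee_fin.
- by apply/measurable_EFinP.
- by move=> x _; rewrite lee_fin.
Qed.

(** * Even moments of a shifted and scaled normal variable *)

Section normal_shifted_moments.
Context {R : realType}.

(** The even terms of the expansion carry [C(2j, 2k) (2k-1)!!], which is at most [C(j, k) q^k]; the
    resulting sum is the binomial expansion of the right side. *)
Lemma normal_shifted_even_moment (u sg : R) (j q : nat) : (j.*2 <= q.+1)%N ->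
  (\int[normal_prob (0:R) 1]_x ((u + sg * (x : R)) ^+ j.*2)%:E <=
   ((u ^+ 2 + sg ^+ 2 * q%:R) ^+ j)%:E)%E.
Proof.
move=> jq; set I := (X in (X <= _)%E).
pose h (x : R) := (u + sg * x) ^+ j.*2.
have h0 x : 0 <= h x by rewrite /h -mul2n exprM exprn_ge0// sqr_ge0.
have mh : measurable_fun setT h.
  by apply: measurable_funX; apply: measurable_funD.
have mhN : measurable_fun setT (fun x : R => h (- x)).
  by apply: measurableT_comp => //; exact: oppr_measurable.
(* Averaging over w and - w removes the odd powers without integrability. *)
rewrite -(@lee_pmul2l R 2%:E)//.
have -> : (2%:E * I = \int[normal_prob (0:R) 1]_x (h x + h (- x))%:E)%E.
  under [RHS]eq_integral do rewrite EFinD.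
  rewrite ge0_integralD//; first last.
  - exact/measurable_EFinP.
  - by move=> x _; rewrite lee_fin.
  - exact/measurable_EFinP.
  - by move=> x _; rewrite lee_fin.
  rewrite (@ge0_integral_normal_probN _ _ (EFin \o h))//.
  - by rewrite mule_natl mule2n.
  - exact/measurable_EFinP.
pose a (k : 'I_j.+1) : R :=
  2 * ((u ^+ 2) ^+ (j - k) * (sg ^+ 2) ^+ k *+ 'C(j.*2, k.*2)).
have a0 k : 0 <= a k.
  by rewrite mulr_ge0// mulrn_wge0// mulr_ge0// exprn_ge0// sqr_ge0.
have hE x : h x + h (- x) = \sum_k a k * x ^+ k.*2.
  rewrite /h mulrN exprDn_even_part -mulr_natl mulr_sumr; apply: eq_bigr => k _.
  rewrite -[in RHS]mul2n [x ^+ _]exprM (exprMn 2) (exprMn k (sg ^+ 2)).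
  rewrite /a -[RHS]mulrA; congr (2 * _).
  by rewrite mulrnAl mulrA.
under eq_integral do rewrite hE.
apply: (@le_trans _ _ (\sum_(k < j.+1) a k * (\prod_(i < k) i.*2.+1)%:R)%:E).
  apply: (@le_integral_sum_nonneg _ (measurableTypeR R) R (normal_prob 0 1)
    _ a _ (fun k (x : R) => x ^+ k.*2)) => //.
- by move=> k x /=; rewrite -mul2n exprM exprn_ge0// sqr_ge0.
- by move=> k; exact: normal_even_moment.
rewrite -EFinM lee_fin exprDn mulr_sumr; apply: ler_sum => k _.
rewrite /a -mulrA ler_wpM2l// (exprMn k (sg ^+ 2)).
have y0 : 0 <= (u ^+ 2) ^+ (j - k) * (sg ^+ 2) ^+ k.
  by rewrite mulr_ge0// exprn_ge0// sqr_ge0.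
rewrite [in leRHS]mulrA; move: (_ * (sg ^+ 2) ^+ k) y0 => y y0.
rewrite -[in leLHS]mulr_natr -mulrA -[leRHS]mulr_natr -[leRHS]mulrA ler_wpM2l//.
rewrite -natrX -!natrM ler_nat [leqRHS]mulnC.
exact: bin_double_odd_prod_le.
Qed.

(** The constant [c] will hold 1 and the contributions of the other coordinates. Expanding in powers
    of [c] reduces to the previous bound, where one [q] serves all exponents [j <= m]. *)
Lemma normal_shifted_moment_le (c u sg : R) (m q : nat) : 0 <= c ->
  (m.*2 <= q.+1)%N ->
  (\int[normal_prob (0:R) 1]_x ((c + (u + sg * (x : R)) ^+ 2) ^+ m)%:E <=
   ((c + (u ^+ 2 + sg ^+ 2 * q%:R)) ^+ m)%:E)%E.
Proof.
move=> c0 mq.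
pose a (j : 'I_m.+1) : R := c ^+ (m - j) *+ 'C(m, j).
under eq_integral => x _.
  rewrite (_ : _ ^+ m = \sum_j a j * (u + sg * x) ^+ j.*2); last first.
    by rewrite exprDn; apply: eq_bigr => j _; rewrite -exprM mul2n mulrnAl.
  over.
apply: (@le_trans _ _
  (\sum_(j < m.+1) a j * (u ^+ 2 + sg ^+ 2 * q%:R) ^+ j)%:E).
  apply: (@le_integral_sum_nonneg _ (measurableTypeR R) R (normal_prob 0 1)
    _ a _ (fun j (x : R) => (u + sg * x) ^+ j.*2)) => //.
- by move=> j; rewrite mulrn_wge0// exprn_ge0.
- by move=> j; apply: measurable_funX; apply: measurable_funD.
- by move=> j x; rewrite -mul2n exprM exprn_ge0// sqr_ge0.
- move=> j; apply: normal_shifted_even_moment; apply: leq_trans mq.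
  by rewrite leq_double -ltnS.
- by rewrite lee_fin exprDn; apply: ler_sum => j _; rewrite mulrnAl.
Qed.

End normal_shifted_moments.

(** * Moments of a shifted Gaussian vector *)

Section gaussian_moments.
Context {R : realType}.
Local Notation mR := (measurableTypeR R).

Lemma dotrV_ge0 n (x : 'rV[R]_n) : 0 <= dotrV x x.
Proof. by apply: sumr_ge0 => i _; rewrite -expr2 sqr_ge0. Qed.

Lemma measurable_dotrV d (T : measurableType d) n (g h : T -> 'rV[R]_n) :
  measurable_fun setT g -> measurable_fun setT h ->
  measurable_fun setT (fun t => dotrV (g t) (h t)).
Proof.
move=> /measurable_fun_rVP mg /measurable_fun_rVP mh.
by apply: measurable_sum => i; exact: measurable_funM.
Qed.

Lemma measurable_affine_rV d (T : measurableType d) n (g h : T -> 'rV[R]_n)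
    (c : R) :
  measurable_fun setT g -> measurable_fun setT h ->
  measurable_fun setT (fun t => g t + c *: h t).
Proof.
move=> /measurable_fun_rVP mg /measurable_fun_rVP mh.
apply/measurable_fun_rVP => i; rewrite (_ : (fun _ => _) =
  fun t => g t ord0 i + c * h t ord0 i).
  by apply: measurable_funD => //; exact: measurable_funM.
by apply/funext => t; rewrite !mxE.
Qed.

(** Isolates the coordinate that the recursive product measure integrates separately. *)
Lemma dotrV_add_rVcons n (y : 'rV[R]_n.+1) (sg : R) (p : mR * 'rV[R]_n) :
  let y' : 'rV[R]_n := \row_i y ord0 (lift ord0 i) in
  dotrV (y + sg *: rVcons p) (y + sg *: rVcons p) =
  (y ord0 ord0 + sg * p.1) ^+ 2 + dotrV (y' + sg *: p.2) (y' + sg *: p.2).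
Proof.
move=> y'; rewrite /dotrV big_ord_recl.
have -> : (y + sg *: rVcons p) ord0 ord0 = y ord0 ord0 + sg * p.1.
  rewrite mxE [X in _ + X]mxE; congr (_ + _ * _).
  have -> : ord0 = @lshift 1 n ord0 by exact/val_inj.
  by rewrite /rVcons (@row_mxEl _ 1 1 n) mxE.
rewrite -expr2; congr (_ + _); apply: eq_bigr => i _.
suff -> : (y + sg *: rVcons p) ord0 (lift ord0 i) =
  (y' + sg *: p.2) ord0 i by [].
rewrite mxE [X in _ + X]mxE [RHS]mxE [X in _ = X + _]mxE [X in _ = _ + X]mxE.
congr (_ + _ * _); have -> : lift ord0 i = @rshift 1 n i by exact/val_inj.
by rewrite /rVcons (@row_mxEr _ 1 1 n).
Qed.

(** Induction on the dimension: by Tonelli the first coordinate is integrated with the others fixed,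
    their squared norm being counted in the constant of the one-dimensional bound. *)
Lemma std_gaussian_moment_le n (m q : nat) (c sg : R) (y : 'rV[R]_n) :
  0 <= c -> (m.*2 <= q.+1)%N ->
  (\int[std_gaussian n]_v ((c + dotrV (y + sg *: v) (y + sg *: v)) ^+ m)%:E <=
   ((c + dotrV y y + n%:R * (sg ^+ 2 * q%:R)) ^+ m)%:E)%E.
Proof.
move=> + mq; pose F c n (y v : 'rV[R]_n) :=
  ((c + dotrV (y + sg *: v) (y + sg *: v)) ^+ m)%:E.
have mF c' n' (y' : 'rV[R]_n') : measurable_fun setT (F c' n' y').
  apply/measurable_EFinP; apply: measurable_funX; apply: measurable_funD => //.
  by apply: measurable_dotrV; apply: measurable_affine_rV.
have F0 c' n' (y' v : 'rV[R]_n') : 0 <= c' -> (0 <= F c' n' y' v)%E.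
  by move=> c'0; rewrite lee_fin exprn_ge0// addr_ge0// dotrV_ge0.
elim: n c y => [c y c0|n IH c y c0].
  rewrite -/(F c 0%N y) integral_dirac//; last exact: mF.
  by rewrite diracE mem_set// mul1e mul0r addr0 scaler0 addr0.
pose y' : 'rV[R]_n := \row_i y ord0 (lift ord0 i).
rewrite -/(F c n.+1 y) ge0_integral_pushforward//; last 2 first.
- exact: mF.
- by move=> v _; exact: F0.
rewrite fubini_tonelli2//; last 2 first.
- exact: (measurableT_comp (mF _ _ _) (@measurable_rVcons R n)).
- by move=> p; exact: F0.
have sgq : 0 <= y ord0 ord0 ^+ 2 + sg ^+ 2 * q%:R.
  by rewrite addr_ge0 ?sqr_ge0// mulr_ge0// sqr_ge0.
have dy : dotrV y y = y ord0 ord0 ^+ 2 + dotrV y' y'.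
  rewrite /dotrV big_ord_recl -expr2; congr (_ + _).
  by apply: eq_bigr => i _; rewrite mxE.
(* What the first coordinate leaves behind, [y_0^2 + sg^2 q], joins [c]; hence the induction lets
   [c] vary. *)
apply: (@le_trans _ _ (\int[std_gaussian n]_v
  F (c + (y ord0 ord0 ^+ 2 + sg ^+ 2 * q%:R))%R n y' v)%E); last first.
  apply: le_trans (IH _ _ _) _; first exact: addr_ge0.
  rewrite lee_fin dy (natrD _ 1 n) le_eqVlt; apply/orP; left; apply/eqP.
  by congr (_ ^+ _); ring.
apply: ge0_le_integral => //.
- by move=> v _; apply: integral_ge0 => w _; exact: F0.
- apply: (@measurable_fun_fubini_tonelli_G _ _ mR 'rV[R]_n R (normal_prob 0 1)).
    exact: (measurableT_comp (mF _ _ _) (@measurable_rVcons R n)).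
  by move=> p; exact: F0.
- exact: mF.
move=> v _; rewrite /fubini_G.
under eq_integral => w _ do rewrite /= dotrV_add_rVcons /= addrA addrAC.
apply: le_trans (normal_shifted_moment_le _ _ _ mq) _.
  by rewrite addr_ge0// dotrV_ge0.
by rewrite lee_fin le_eqVlt; apply/orP; left; apply/eqP; congr (_ ^+ _); ring.
Qed.
End gaussian_moments.

(** * The real inequality behind one step *)

Section one_step.
Context {R : realType}.

Lemma le_powR_base (x y e : R) : 0 <= x -> 0 <= e -> x <= y -> x `^ e <= y `^ e.
Proof.
by move=> x0 e0 xy; apply: ge0_ler_powR; rewrite ?nnegrE// (le_trans x0).
Qed.

(** The difference of the powers factors as [h] times [m] products, each at most [(B + h)^(m-1)]. *)
Lemma exprD_le_linear (B h : R) m : 0 <= B -> 0 <= h ->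
  (B + h) ^+ m <= B ^+ m + m%:R * h * (B + h) ^+ m.-1.
Proof.
move=> B0 h0; rewrite -lerBlDl subrXX [B + h - B]addrAC subrr add0r.
rewrite -mulrA mulrCA ler_wpM2l// mulr_natl -[X in _ *+ X](card_ord m).
rewrite -sumr_const.
apply: ler_sum => i _; have im : (i <= m.-1)%N by have := ltn_ord i; lia.
rewrite -[in leRHS](subnK im) exprD ler_wpM2l ?exprn_ge0 ?addr_ge0//.
by rewrite lerXn2r ?nnegrE ?addr_ge0// lerDl.
Qed.

Lemma drift_power_le (alpha a b eta r A : R) (m d : nat) :
  1 <= alpha <= 2 -> 0 < a -> 0 < b -> 0 < eta -> eta <= 2^-1 ->
  (0 < m)%N -> (0 < d)%N -> 0 <= r -> 0 <= A ->
  A <= 1 + r ^+ 2 + eta *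
    (2 * b + a + d%:R * (4 * m%:R - 2) - 3 / 2 * a * r `^ alpha) ->
  let p : R := (m.*2%:R - 2) / alpha + 1 in
  let C : R := ((3 * a + 2 * b + 3) / Num.min 1 a) `^ p *
    m.*2%:R ^+ m.*2 * d%:R `^ p in
  A ^+ m <= (1 + r ^+ 2) ^+ m + C * eta.
Proof.
move=> /andP[al1 al2] a0 b0 eta0 eta12 m0 d0 r0 A0.
have al0 : 0 < alpha by apply: lt_le_trans al1.
pose N := 2 * b + a + d%:R * (4 * m%:R - 2).
rewrite -/N => hA; cbv zeta; set p : R := (_ - 2) / alpha + 1.
set C : R := _ * _ * _ `^ p.
have m1 : 1 <= m%:R :> R by rewrite ler1n.
have d1 : 1 <= d%:R :> R by rewrite ler1n.
set K := (3 * a + 2 * b + 3) / Num.min 1 a in C *.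
have min0 : 0 < Num.min 1 a by rewrite lt_min ltr01.
have min1 : Num.min 1 a <= 1 by rewrite ge_min lexx.
have mina : Num.min 1 a <= a by rewrite ge_min lexx orbT.
have Kmin : K * Num.min 1 a = 3 * a + 2 * b + 3 by rewrite /K divfK// gt_eqF.
have K1 : 1 <= K by rewrite /K ler_pdivlMr// mul1r; lra.
(* [C = (2m)^(2m) Q^p] with [Q^p = Q (Q^(2/alpha))^(m-1)]. *)
pose Q := K * d%:R.
have QK : K <= Q by rewrite /Q ler_peMr//; lra.
have Q1 : 1 <= Q by exact: le_trans QK.
have B0 : 0 <= 1 + r ^+ 2 by rewrite addr_ge0// sqr_ge0.
have N0 : 0 <= N.
  have : 0 <= d%:R * (4 * m%:R - 2) :> R by rewrite mulr_ge0//; lra.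
  rewrite /N; lra.
have NQ : N <= 4 / 3 * m%:R * (Q * Num.min 1 a).
  rewrite /Q [K * _ * _]mulrAC Kmin /N.
  have db : b <= m%:R * d%:R * b by rewrite ler_peMl ?mulr_ege1// ltW.
  have da : a <= m%:R * d%:R * a by rewrite ler_peMl ?mulr_ege1// ltW.
  have b0' := ltW b0; have a0' := ltW a0; lra.
have C0 : 0 <= C by rewrite /C !mulr_ge0 ?powR_ge0// exprn_ge0.
have [Nle|Ngt] := leP N (3 / 2 * a * r `^ alpha).
  rewrite (@le_trans _ _ ((1 + r ^+ 2) ^+ m))//; last first.
    by rewrite lerDl mulr_ge0// ltW.
  rewrite lerXn2r ?nnegrE// (le_trans hA)// gerDl pmulr_rle0// subr_le0//.
have mQ0 : 0 <= m%:R * Q by rewrite mulr_ge0// (le_trans ler01).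
(* Now [a r^alpha < (2/3) N <= (8/9) m Q min(1, a)], and [min(1, a) <= a]. *)
have rQ : r `^ alpha <= m%:R * Q.
  rewrite -(ler_pM2l a0).
  have : m%:R * Q * Num.min 1 a <= a * (m%:R * Q) by rewrite mulrC ler_wpM2r.
  have := ltW Ngt; lra.
(* Since [alpha >= 1], the exponent [2 / alpha] is at most 2, so [m^(2/alpha) <= m^2]. *)
have r2 : r ^+ 2 <= m%:R ^+ 2 * Q `^ (2 / alpha).
  have -> : r ^+ 2 = (r `^ alpha) `^ (2 / alpha).
    by rewrite -powRrM mulrC divfK ?gt_eqF// powR_mulrn.
  rewrite (@le_trans _ _ ((m%:R * Q) `^ (2 / alpha)))//.
    by apply: le_powR_base; rewrite ?powR_ge0// divr_ge0// ltW.
  rewrite powRM ?(le_trans ler01)// ler_wpM2r ?powR_ge0//.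
  rewrite -powR_mulrn//; apply: ler_powR => //.
  by rewrite ler_pdivrMr//; lra.
(* This is where [alpha <= 2] enters. *)
have QQ : Q <= Q `^ (2 / alpha).
  apply: le1r_powR => //.
  by rewrite ler_pdivlMr// mul1r.
have N2Q : N <= 4 / 3 * m%:R * Q.
  have : m%:R * Q * Num.min 1 a <= m%:R * Q by rewrite ler_piMr.
  lra.
(* The three summands are at most 1, 1 and 2/3 times [m^2 Q^(2/alpha)], the last by [eta <= 1/2]. *)
have BN : 1 + r ^+ 2 + eta * N <= 4 * m%:R ^+ 2 * Q `^ (2 / alpha).
  set Z := Q `^ (2 / alpha) in r2 QQ *.
  have Z1 : 1 <= Z by exact: le_trans QQ.
  have eN : eta * N <= 2^-1 * N by rewrite ler_wpM2r.
  have mQZ : m%:R * Q <= m%:R ^+ 2 * Z.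
    rewrite expr2 -mulrA ler_wpM2l// (le_trans QQ)// ler_peMl//.
    exact: le_trans Z1.
  have m2Z : 1 <= m%:R ^+ 2 * Z by rewrite mulr_ege1// exprn_ege1.
  lra.
have eN0 : 0 <= eta * N by rewrite mulr_ge0// ltW.
have le1 : A ^+ m <= (1 + r ^+ 2 + eta * N) ^+ m.
  apply: lerXn2r; rewrite ?nnegrE ?addr_ge0 ?sqr_ge0//.
  apply: (le_trans hA); rewrite lerD2l; apply: ler_wpM2l; first exact: ltW.
  rewrite gerBl.
  by rewrite !mulr_ge0 ?powR_ge0// ltW.
apply: (le_trans le1); apply: (le_trans (exprD_le_linear _ _ _)) => //.
suff fin : m%:R * N * (1 + r ^+ 2 + eta * N) ^+ m.-1 <= C.
  rewrite lerD2l [leLHS](_ : _ = m%:R * N * (1 + r ^+ 2 + eta * N) ^+ m.-1 * eta);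
    last by ring.
  by apply: ler_wpM2r => //; exact: ltW.
have K0 : 0 <= K by exact: le_trans ler01 K1.
have Q0 : 0 <= Q by exact: le_trans ler01 Q1.
(* One factor [4 m^2 Q] is split off to dominate [m N]; the remaining [m-1] factors dominate the
   power. *)
have -> : C = 4 * m%:R ^+ 2 * Q * (4 * m%:R ^+ 2 * Q `^ (2 / alpha)) ^+ m.-1.
  have -> : C = m.*2%:R ^+ m.*2 * Q `^ p by rewrite /C /Q powRM// mulrAC mulrC.
  have pE : p = 1 + 2 / alpha * m.-1%:R.
    rewrite /p -mul2n natrM -{1}(prednK m0) -[m.-1.+1]addn1 natrD.
    by field; rewrite gt_eqF.
  rewrite pE powRD; last by rewrite (gt_eqF (lt_le_trans ltr01 Q1)) implybT.
  rewrite powRr1// powRrM powR_mulrn ?powR_ge0// -mul2n exprM.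
  have -> : (2 * m)%:R ^+ 2 = 4 * m%:R ^+ 2 :> R by rewrite natrM; ring.
  have -> : (4 * m%:R ^+ 2 : R) ^+ m = 4 * m%:R ^+ 2 * (4 * m%:R ^+ 2) ^+ m.-1.
    by rewrite -exprS prednK.
  by rewrite [in RHS]exprMn [RHS]mulrACA.
apply: ler_pM.
- by rewrite mulr_ge0.
- by rewrite exprn_ge0// addr_ge0.
- have := @ler_wpM2l _ m%:R (ler0n _ _) _ _ N2Q.
  have : 0 <= m%:R ^+ 2 * Q by rewrite mulr_ge0// exprn_ge0.
  by rewrite expr2; lra.
- have W0 : 0 <= 1 + r ^+ 2 + eta * N by rewrite addr_ge0.
  by apply: lerXn2r; rewrite ?nnegrE// (le_trans W0).
Qed.
End one_step.

(** * Measurability of the gradient, and the joint law of iterate and noise *)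

(** Each partial derivative is a pointwise limit of difference quotients with steps [1/(m+1)], and
    these are continuous in [x]. *)
Lemma measurable_grad (R : realType) (n : nat) (f : 'rV[R]_n -> R) :
  (forall x, differentiable f x) -> measurable_fun setT (grad f).
Proof.
move=> df; apply/measurable_fun_rVP => i.
rewrite (_ : (fun _ => _) = 'D_(delta_mx ord0 i) f); last first.
  by apply/funext => x; rewrite mxE.
set v : 'rV[R]_n := delta_mx ord0 i.
have cf : continuous f by move=> x; exact: differentiable_continuous.
have mf := continuous_measurable_rV cf.
have dv x : derivable f x v by exact: diff_derivable.
apply: (@measurable_fun_cvg _ _ _ _
  (fun m x => (harmonic m)^-1 * (f (harmonic m *: v + x) - f x))) => [m|x _].
  have mfm : measurable_fun setT (fun x => f (harmonic m *: v + x)).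
    apply: continuous_measurable_rV => x.
    apply: continuous_comp; last exact: cf.
    exact: (cvgD (cvg_cst _) cvg_id).
  exact: (measurable_funM (measurable_cst _) (measurable_funB mfm mf)).
have /cvgr_dnbhsP := dv x.
apply; split=> [m|]; last exact: cvg_harmonic.
by rewrite gt_eqF// harmonic_gt0.
Qed.

Section lmc_step.
Context {R : realType} {d : nat} {dT : measure_display} {T : measurableType dT}.
Variables (P : probability T R) (f : 'rV[R]_d -> R) (eta : R).
Variables X W : nat -> {RV P >-> 'rV[R]_d}.
Hypothesis XW : lmc f eta X W.

(** By independence the joint law of [X k] and [W k] agrees with the product measure on rectangles,
    hence everywhere; Tonelli then gives the iterated integral. *)
Lemma lmc_integral_pair k (F : 'rV[R]_d * 'rV[R]_d -> \bar R) :
  measurable_fun setT F -> (forall p, 0 <= F p)%E ->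
  (\int[P]_t F (X k t, W k t) =
   \int[distribution P (X k)]_x \int[std_gaussian d]_w F (x, w))%E.
Proof.
move=> mF F0; have [Wlaw indep _] := XW k.
have mXW : measurable_fun setT (fun t => (X k t, W k t)).
  exact: measurable_fun_pair.
pose XWk : {mfun T >-> ('rV[R]_d * 'rV[R]_d)%type} :=
  HB.pack (fun t => (X k t, W k t)) (isMeasurableFun.Build _ _ _ _ _ mXW).
have lawE : forall A, measurable A ->
    (distribution P (X k) \x std_gaussian d)%E A = pushforward P XWk A.
  apply: product_measure_unique => A B mA mB.
  rewrite -Wlaw// /distribution /pushforward muleC -indep//; last first.
    (* The past at [k] includes [X k] itself. *)
    apply: sub_sigma_algebra; left; exists k => //=.
    by exists A => //; rewrite setTI.
  by congr (P _); apply/seteqP; split => t [].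
rewrite -(fubini_tonelli1 F)//.
rewrite (eq_measure_integral (pushforward P XWk)); last first.
  by move=> A mA _; exact: lawE.
by rewrite ge0_integral_pushforward.
Qed.
End lmc_step.

(** * Even moments as integer powers, and the drift step *)

Section moments.
Context {R : realType} {d : nat}.

Lemma enorm_sqr (x : 'rV[R]_d) : enorm x ^+ 2 = dotrV x x.
Proof. by rewrite sqr_sqrtr// dotrV_ge0. Qed.

Lemma momentE m (mu : {measure set 'rV[R]_d -> \bar R}) :
  moment m.*2%:R mu = (\int[mu]_x ((1 + dotrV x x) ^+ m)%:E)%E.
Proof.
apply: eq_integral => x _; rewrite enorm_sqr -muln2 natrM mulfK// powR_mulrn//.
by rewrite addr_ge0// dotrV_ge0.
Qed.

Lemma measurable_moment_fun m :
  measurable_fun setT (fun x : 'rV[R]_d => ((1 + dotrV x x) ^+ m)%:E).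
Proof.
apply/measurable_EFinP; apply: measurable_funX; apply: measurable_funD => //.
by apply: measurable_dotrV.
Qed.

Lemma moment_fun_ge0 m (x : 'rV[R]_d) : (0 <= ((1 + dotrV x x) ^+ m)%:E)%E.
Proof. by rewrite lee_fin exprn_ge0// addr_ge0// dotrV_ge0. Qed.

(** Expand the square: dissipativity bounds the cross term, while growth and the step size give
    [eta |g|^2 <= a (1 + r^alpha / 2)], a quarter of the dissipation in [r^alpha]. *)
Lemma gradient_step_le (g x : 'rV[R]_d) (a b alpha zeta M eta : R) :
  1 <= alpha -> 0 < zeta -> zeta <= alpha / 2 -> 0 < a ->
  a * enorm x `^ alpha - b <= dotrV g x ->
  enorm g <= M * (1 + enorm x `^ zeta) ->
  0 < eta -> eta <= a / (4 * M ^+ 2) ->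
  dotrV (x - eta *: g) (x - eta *: g) <=
  enorm x ^+ 2 + eta * (2 * b + a - 3 / 2 * a * enorm x `^ alpha).
Proof.
move=> al1 z0 zal a0 dis gro eta0 etaM.
have -> : dotrV (x - eta *: g) (x - eta *: g) =
    dotrV x x - 2 * eta * dotrV g x + eta ^+ 2 * dotrV g g.
  rewrite /dotrV !mulr_sumr -sumrB -big_split/=; apply: eq_bigr => i _.
  by rewrite !mxE; ring.
rewrite -!enorm_sqr.
set r := enorm x in dis gro *; set h := enorm g in gro *.
have r0 : 0 <= r by exact: sqrtr_ge0.
have h0 : 0 <= h by exact: sqrtr_ge0.
(* Division by 0 yields 0, so [M = 0] would force [eta <= 0]. *)
have M20 : 0 < M ^+ 2.
  rewrite lt_neqAle sqr_ge0 andbT eq_sym; apply/eqP => M2.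
  by move: etaM; rewrite M2 mulr0 invr0 mulr0 leNgt eta0.
have etaMa : 4 * (eta * M ^+ 2) <= a.
  have M4 : 0 < 4 * M ^+ 2 by rewrite mulr_gt0 ?ltr0n.
  by move: etaM; rewrite (ler_pdivlMr _ _ M4) mulrCA.
(* As [2 zeta <= alpha], the power is at most 1 for [r <= 1] and at most [r^alpha] beyond. *)
have rz : (r `^ zeta) ^+ 2 <= 1 + r `^ alpha.
  have -> : (r `^ zeta) ^+ 2 = r `^ (zeta * 2).
    by rewrite powRrM powR_mulrn ?powR_ge0.
  have [r1|r1] := leP r 1.
    rewrite (@le_trans _ _ 1) ?lerDl ?powR_ge0//.
    have := @le_powR_base R r 1 (zeta * 2) r0 _ r1; rewrite powR1; apply.
    by rewrite mulr_ge0// ltW.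
  rewrite (@le_trans _ _ (r `^ alpha)) ?lerDr//.
  by apply: ler_powR; [exact: ltW|rewrite -ler_pdivlMr].
(* Uses [(1 + t)^2 <= 2 + 2 t^2] with [t = r^zeta]. *)
have h2 : h ^+ 2 <= M ^+ 2 * (4 + 2 * r `^ alpha).
  have : h ^+ 2 <= (M * (1 + r `^ zeta)) ^+ 2.
    by rewrite lerXn2r ?nnegrE// (le_trans h0).
  have := sqr_ge0 (r `^ zeta - 1); rewrite exprMn => s1 /le_trans; apply.
  by rewrite ler_wpM2l ?sqr_ge0//; nra.
have eh : eta * h ^+ 2 <= a * (1 + r `^ alpha / 2).
  apply: (@le_trans _ _ (eta * (M ^+ 2 * (4 + 2 * r `^ alpha)))).
    by rewrite ler_wpM2l// ltW.
  have : 0 <= r `^ alpha by exact: powR_ge0.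
  nra.
have := ler_wpM2l (ltW eta0) eh; have := ler_wpM2l (ltW eta0) dis.
lra.
Qed.
End moments.

(** * Moment increment over one step of the chain *)

Section lmc_moment.
Context {R : realType} {d : nat} {dT : measure_display} {T : measurableType dT}.
Variables (P : probability T R) (f : 'rV[R]_d -> R) (eta : R).
Variables X W : nat -> {RV P >-> 'rV[R]_d}.

(** Integrate the noise first, with the iterate fixed, then apply the pointwise bound; the noise has
    variance [2 eta] per coordinate. Moments are extended reals and may be infinite. *)
Lemma lmc_moment_step (m q : nat) (c : R) k : lmc f eta X W ->
  (forall x, differentiable f x) -> 0 <= eta -> (m.*2 <= q.+1)%N -> 0 <= c ->
  (forall x, (1 + dotrV (x - eta *: grad f x) (x - eta *: grad f x) +
      d%:R * (2 * eta * q%:R)) ^+ m <= (1 + dotrV x x) ^+ m + c) ->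
  (moment m.*2%:R (distribution P (X k.+1)) <=
   moment m.*2%:R (distribution P (X k)) + c%:E)%E.
Proof.
move=> XW df eta0 mq c0 hstep; rewrite !momentE.
pose y x := x - eta *: grad f x; pose sg := Num.sqrt (2 * eta).
have sg2 : sg ^+ 2 = 2 * eta by rewrite sqr_sqrtr// mulr_ge0.
pose F (p : 'rV[R]_d * 'rV[R]_d) :=
  ((1 + dotrV (y p.1 + sg *: p.2) (y p.1 + sg *: p.2)) ^+ m)%:E.
have my : measurable_fun setT y.
  rewrite (_ : y = fun x => x + (- eta) *: grad f x); last first.
    by apply/funext => x; rewrite scaleNr.
  by apply: measurable_affine_rV => //; exact: measurable_grad.
have mF : measurable_fun setT F.
  apply: (measurableT_comp (measurable_moment_fun m)).
  apply: measurable_affine_rV; last exact: measurable_snd.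
  exact: (measurableT_comp my measurable_fst).
have F0 p : (0 <= F p)%E by exact: moment_fun_ge0.
have mg := @measurable_moment_fun R d m.
rewrite ge0_integral_distribution//; last by move=> x; exact: moment_fun_ge0.
have -> : (\int[P]_t ((fun x => ((1 + dotrV x x) ^+ m)%:E) \o X k.+1) t =
    \int[P]_t F (X k t, W k t))%E.
  by apply: eq_integral => t _; have [_ _ /(_ t) /= ->] := XW k.
rewrite (lmc_integral_pair XW)//.
apply: (@le_trans _ _
  (\int[distribution P (X k)]_x ((1 + dotrV x x) ^+ m + c)%:E)%E).
  apply: ge0_le_integral => //.
  - by move=> x _; apply: integral_ge0.
  - exact: (measurable_fun_fubini_tonelli_F _ mF F0).
  - by under eq_fun do rewrite EFinD; apply: emeasurable_funD.
  move=> x _.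
  have := @std_gaussian_moment_le R d m q 1 sg (y x) ler01 mq.
  rewrite sg2 => /le_trans; apply.
  by rewrite lee_fin; exact: hstep.
under eq_integral do rewrite EFinD.
rewrite ge0_integralD//; last by move=> x _; exact: moment_fun_ge0.
rewrite integral_cst// [X in (_ + _ * X)%E](_ : _ = 1%E) ?mule1//.
exact: probability_setT.
Qed.
End lmc_moment.

(** * Accumulation over [k] steps *)

Theorem proposition2 (R : realType) (d : nat) (f : potential R d)
    (alpha a b zeta M eta : R)
    (dT : measure_display) (T : measurableType dT) (P : probability T R)
    (X W : nat -> {RV P >-> 'rV[R]_d})
    (alpha_range : 1 <= alpha <= 2) (a_gt0 : 0 < a) (b_gt0 : 0 < b)
    (dissipative : forall x : 'rV[R]_d,
      a * enorm x `^ alpha - b <= dotrV (grad f x) x)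
    (zeta_gt0 : 0 < zeta) (zeta_le : zeta <= alpha / 2)
    (grad_growth : forall x : 'rV[R]_d,
      enorm (grad f x) <= M * (1 + enorm x `^ zeta))
    (eta_gt0 : 0 < eta)
    (eta_le : eta <= 2^-1 * Num.min 1 (a / (2 * M ^+ 2)))
    (XW_lmc : lmc f eta X W)
    (s : nat) (s_even : ~~ odd s) (s_ge2 : (2 <= s)%N) (k : nat) :
  let p : R := (s%:R - 2) / alpha + 1 in
  let C : R := ((3 * a + 2 * b + 3) / Num.min 1 a) `^ p * s%:R ^+ s * d%:R `^ p in
  (moment s%:R (measure_add (distribution P (X k)) (gibbs f)) <=
   moment s%:R (measure_add (distribution P (X 0%N)) (gibbs f))
     + (C * k%:R * eta)%:E)%E.
Proof.
have eta12 : eta <= 2^-1.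
  by apply: (le_trans eta_le); rewrite ler_piMr// ge_min lexx.
have etaM : eta <= a / (4 * M ^+ 2).
  apply: (le_trans eta_le).
  have -> : a / (4 * M ^+ 2) = 2^-1 * (a / (2 * M ^+ 2)).
    by rewrite [RHS]mulrCA -invfM; congr (_ / _); ring.
  by rewrite ler_wpM2l// ge_min lexx orbT.
have [m sm] : exists m, s = m.*2 by exists s./2; rewrite even_halfK.
have m_gt0 : (0 < m)%N by move: s_ge2; rewrite sm; case: (m).
rewrite {s s_even s_ge2}sm; cbv zeta.
set C : R := (_ `^ _ * _ * _).
have C0 : 0 <= C by rewrite /C !mulr_ge0 ?powR_ge0// exprn_ge0.
have step j : (moment m.*2%:R (distribution P (X j.+1)) <=
    moment m.*2%:R (distribution P (X j)) + (C * eta)%:E)%E.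
  (* The choice [q = 2m - 1] is the least that the Gaussian bound admits. *)
  apply: (lmc_moment_step (q := m.*2.-1) j XW_lmc).
  - exact: potential_differentiable.
  - exact: ltW.
  - by rewrite leqSpred.
  - by rewrite mulr_ge0// ltW.
  move=> x.
  (* In dimension 0 all norms vanish; [drift_power_le] covers only [d > 0]. *)
  have [d0|d_gt0] := posnP d.
    have dot0 (z : 'rV[R]_d) : dotrV z z = 0.
      by rewrite /dotrV big1// => i; have := ltn_ord i; rewrite {2}d0.
    by rewrite !dot0 d0 mul0r !addr0 expr1n lerDl mulr_ge0// ltW.
  have [al1 al2] := andP alpha_range.
  have /= := gradient_step_le al1 zeta_gt0 zeta_le a_gt0 (dissipative x)
    (grad_growth x) eta_gt0 etaM.
  rewrite -[dotrV x x]enorm_sqr => hy.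
  apply: drift_power_le => //; first exact: sqrtr_ge0.
    by rewrite !addr_ge0 ?dotrV_ge0// !mulr_ge0// ltW.
  have -> : (m.*2.-1)%:R = 2 * m%:R - 1 :> R.
    by rewrite -subn1 natrB ?double_gt0// -mul2n natrM.
  lra.
have moment_iter : (moment m.*2%:R (distribution P (X k)) <=
    moment m.*2%:R (distribution P (X 0%N)) + (C * k%:R * eta)%:E)%E.
  elim: k => [|k IH]; first by rewrite mulr0 mul0r adde0.
  apply: (le_trans (step k)); apply: (le_trans (leeD2r _ IH)).
  rewrite -addeA -EFinD -[k.+1]addn1 natrD; apply: leeD2l.
  by rewrite lee_fin; lra.
(* The moment is additive in the measure, and the same Gibbs term appears on both sides. *)
rewrite !momentE in moment_iter *; have mg := @measurable_moment_fun R d m.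
have g0 x : setT x -> (0 <= ((1 + @dotrV R d x x) ^+ m)%:E)%E.
  by move=> _; exact: moment_fun_ge0.
rewrite !ge0_integral_measure_add// [leRHS]addeAC; exact: leeD2r.
Qed.
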